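(* (1) If $\Phi(z)$ is a $(v,k,k)$-polyphase BIBD ETF over an abelian group $\mathcal{G}$ of order $k$, then $$Z=\begin{bmatrix} I_v\otimes\mathbf{1}_k^{\mathrm T}\\ \Phi(T)\end{bmatrix}$$ is the incidence matrix of a $\mathrm{GQ}(k-1,r)$ that contains a spread, where $r=\frac{v-1}{k-1}$. (2) Conversely, let $s\geq1$, $t\geq 2$ be integers. If $$Z=\begin{bmatrix} I_{st+1}\otimes\mathbf{1}_{s+1}^{\mathrm T}\\ Y\end{bmatrix}$$ is the incidence matrix of a $\mathrm{GQ}(s,t)$ that contains a spread, and there exists an abelian group $\mathcal{G}$ of order $s+1$ such that $Y$ is a $\frac{t(st+1)}{s+1}\times(st+1)$ array of $(s+1)\times(s+1)$ blocks that are each either a $\mathcal{G}$-circulant permutation matrix or the zero matrix, then there exists an $(st+1,s+1,s+1)$-polyphase BIBD ETF $\Phi(z)$ (over $\mathcal{G}$) such that $Y=\Phi(T)$. (3) In this case (with $s=k-1$, $t=r$, $v=st+1$), for every nontrivial character $\gamma$ of $\mathcal{G}$ the columns of $\Phi(\gamma)$ form an ETF of $n$ vectors for their span, of dimension $d$, where $$d=\frac{t(st+1)}{s+t},\qquad n=st+1,\qquad n-d=\frac{s(st+1)}{s+t}.$$ Moreover, when $s+1$ is even, $\gamma$ can be chosen so that $\Phi(\gamma)$ is a real ETF. (4) Also in this case, $\Phi^*(z)\Phi(z)-tI$ is an abelian $(st+1,s+1,t-1)$-DRACKN.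
   Context: **Polyphase matrices.** For a finite abelian group $\mathcal{G}$ (written additively), elements of the group ring $\mathbb{C}\mathcal{G}$ are written as formal polynomials $x(z)=\sum_{g\in\mathcal{G}}x(g)z^g$ with $x(g)\in\mathbb{C}$, multiplied by $z^{g_1}z^{g_2}=z^{g_1+g_2}$; the multiplicative identity is $1=z^0$. A monomial over $\mathcal{G}$ is an element $z^g$. The conjugate of $x(z)$ is $\overline{x(z)}:=\sum_{g}\overline{x(-g)}z^g$. A polyphase matrix over $\mathcal{G}$ is a matrix with entries in $\mathbb{C}\mathcal{G}$; $\Phi^*(z)$ is the matrix whose $(j,i)$ entry is the conjugate of the $(i,j)$ entry of $\Phi(z)$, and self-adjoint means $A^*(z)=A(z)$. $|\Phi(z)|^2$ is the matrix whose entries are $\overline{x(z)}x(z)$, where $x(z)$ is the corresponding entry of $\Phi(z)$. Scalar matrices are regarded as polyphase matrices with constant entries. A character of $\mathcal{G}$ is a homomorphism $\gamma:\mathcal{G}\to\{\zeta\in\mathbb{C}:|\zeta|=1\}$; $x(\gamma):=\sum_g x(g)\gamma(g)$, and $\Phi(\gamma)$ is obtained by applying this entrywise. **Filter banks.** For $g\in\mathcal{G}$, $T^g$ is the $\mathcal{G}\times\mathcal{G}$ permutation matrix of the translation $(T^g y)(g')=y(g'-g)$ on $\mathbb{C}^{\mathcal{G}}$. $\Phi(T)$ is the block matrix obtained from $\Phi(z)$ by replacing each entry $\sum_g x(g)z^g$ by the $|\mathcal{G}|\times|\mathcal{G}|$ block $\sum_g x(g)T^g$. A matrix $L$ indexed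 by $\mathcal{G}\times\mathcal{G}$ is $\mathcal{G}$-circulant if $L(g',g'')=L(g'-g'',0)$ for all $g',g''$; the $\mathcal{G}$-circulant permutation matrices are the $T^g$. $\mathbf{1}_k$ is the $k\times1$ all-ones vector. **BIBD.** For integers $v>k\geq 2$, a $\mathrm{BIBD}(v,k,1)$ is a $v$-element vertex set with a collection of $b$ subsets (blocks) such that every block contains exactly $k$ vertices and every pair of distinct vertices is in exactly one block. Its incidence matrix is $b\times v$ with rows indexed by blocks and columns by vertices. **ETF.** Vectors $\varphi_1,\dots,\varphi_n\in\mathbb{C}^m$ form an equiangular tight frame (ETF) for their span $H$ if they are nonzero with equal norms, there is $w$ with $|\langle\varphi_i,\varphi_j\rangle|=w$ for all $i\neq j$, and there is $a>0$ with $\sum_i\langle\varphi_i,x\rangle\varphi_i=ax$ for all $x\in H$ (inner product conjugate-linear in the first argument). ''$\Phi(\gamma)$ is a real ETF'' means the entries of $\Phi(\gamma)$ are real and its columns form an ETF for their span ($\gamma$ nontrivial). **Polyphase BIBD ETF.** Let $\mathcal{G}$ be an abelian group of order $f$. A polyphase matrix $\Phi(z)$ whose entries are monomials over $\mathcal{G}$ or zero is a $(v,k,f)$-polyphase BIBD ETF if $|\Phi(z)|^2$ is the incidence matrix of a $\mathrm{BIBD}(v,k,1)$ and, for all nontrivial characters $\gamma$ of $\mathcal{G}$, the columns of $\Phi(\gamma)$ form an ETF for their span. **Generalized quadrangle.** For positive integers $s,t$, a $\mathrm{GQ}(s,t)$ is a set of vertices and a set of blocks (subsets of the vertex set) such that: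 every block contains exactly $s+1$ vertices; every vertex is in exactly $t+1$ blocks; two distinct blocks intersect in at most one vertex; two distinct vertices are contained in at most one block; and if vertex $i$ does not lie in block $j$, there is a unique pair $(i',j')$ such that vertex $i'$ is in blocks $j$ and $j'$ and block $j'$ contains both vertices $i$ and $i'$. Its incidence matrix has rows indexed by blocks and columns by vertices, with entry $1$ iff the vertex is in the block. A spread is a collection of blocks that partition the vertex set; in the matrices $Z$ of the statement, the top block of rows corresponds to a spread. **Abelian DRACKN.** For positive integers $n,f,c$ with $f\geq 2$ and an abelian group $\mathcal{G}$ of order $f$, an abelian $(n,f,c)$-DRACKN is a self-adjoint $n\times n$ polyphase matrix $A(z)$ over $\mathcal{G}$ whose diagonal entries are zero, whose off-diagonal entries are monomials, and which satisfies $[A(z)]^2=(n-fc-2)A(z)+(n-1)I+c\,\mathbf{1}(z)(J-I)$, where $\mathbf{1}(z)=\sum_{g\in\mathcal{G}}z^g$ and $J$ is the all-ones matrix. *)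

(* Defs.v *)
From HB Require Import structures.
From mathcomp Require Import all_boot all_order all_algebra.
From mathcomp Require Import complex mxtens.

Set Implicit Arguments.
Unset Strict Implicit.
Unset Printing Implicit Defensive.

Import Order.TTheory GRing.Theory Num.Theory.
Local Open Scope ring_scope.

(* An element of the group ring C[G] is the function of its coefficients,
   [coef x g] being the coefficient of z^g.  The alias is needed because the
   ring structure that the library puts on [{ffun G -> C}] is the pointwise
   one, whereas here the product is the convolution. *)

Definition group_ring (C : comNzRingType) (G : finZmodType) : Type :=
  {ffun G -> C}.

Section GroupRing.
Variables (C : comNzRingType) (G : finZmodType).
Implicit Types x y z : group_ring C G.

HB.instance Definition _ :=
  GRing.Zmodule.copy (group_ring C G) {ffun G -> C}.

Definition coef x (g : G) : C := (x : {ffun G -> C}) g.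

Definition monomial (g : G) : group_ring C G := [ffun h => (h == g)%:R].

Definition conv x y : group_ring C G :=
  [ffun g => \sum_h coef x h * coef y (g - h)].

Fact coef_conv x y g :
  coef (conv x y) g = \sum_h coef x h * coef y (g - h).
Proof. by rewrite /coef ffunE. Qed.

Fact convC : commutative conv.
Proof.
move=> x y; apply/ffunP=> g; rewrite !ffunE.
rewrite (reindex_inj (inv_inj (subKr g))) /=.
by apply: eq_bigr => h _; rewrite subKr mulrC.
Qed.

Fact convA : associative conv.
Proof.
move=> x y z; apply/ffunP=> g; rewrite !ffunE.
transitivity (\sum_a \sum_h coef x a * (coef y (h - a) * coef z (g - h))).
  apply: eq_bigr => a _; rewrite coef_conv mulr_sumr.
  rewrite (reindex_inj (addIr (- a))) /=.
  by apply: eq_bigr => h _; rewrite opprB addrA subrK.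
rewrite exchange_big /=; apply: eq_bigr => h _.
rewrite coef_conv mulr_suml.
by apply: eq_bigr => a _; rewrite mulrA.
Qed.

Fact conv1x : left_id (monomial 0) conv.
Proof.
move=> x; apply/ffunP=> g; rewrite !ffunE (bigD1 0) //= big1 => [|h h0].
  by rewrite /coef ffunE eqxx mul1r subr0 addr0.
by rewrite /coef ffunE (negPf h0) mul0r.
Qed.

Fact convDl : left_distributive conv +%R.
Proof.
move=> x y z; apply/ffunP=> g; rewrite !ffunE -big_split /=.
by apply: eq_bigr => h _; rewrite /coef ffunE mulrDl.
Qed.

Fact group_ring1_neq0 : monomial 0 != 0.
Proof.
by apply/eqP=> /ffunP/(_ 0); rewrite !ffunE eqxx => /eqP; rewrite oner_eq0.
Qed.

HB.instance Definition _ := GRing.Zmodule_isComNzRing.Build (group_ring C G)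
  convA convC conv1x convDl group_ring1_neq0.

Definition is_monomial x : Prop := exists g, x = monomial g.

(* The element 1(z), the sum of all z^g; not the unit 1 = z^0. *)
Definition all_ones : group_ring C G := \sum_g monomial g.

Definition ev (gamma : G -> C) x : C := \sum_g coef x g * gamma g.

End GroupRing.

Section Polyphase.
Variables (C : numClosedFieldType) (G : finZmodType).
Local Notation CG := (group_ring C G).

Definition gconj (x : CG) : CG := [ffun g => (coef x (- g))^*].

Definition padj m n (Phi : 'M[CG]_(m, n)) : 'M[CG]_(n, m) :=
  (map_mx gconj Phi)^T.

(* |Phi(z)|^2: an entrywise operation, not the product Phi^*(z) Phi(z). *)
Definition abs2 m n (Phi : 'M[CG]_(m, n)) : 'M[CG]_(m, n) :=
  map_mx (fun x => gconj x * x) Phi.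

Definition is_character (gamma : G -> C) : Prop :=
  (forall g h, gamma (g + h) = gamma g * gamma h)
  /\ (forall g, `|gamma g| = 1).

Definition nontrivial (gamma : G -> C) : Prop := exists g, gamma g != 1.

Definition mxev (gamma : G -> C) m n (Phi : 'M[CG]_(m, n)) : 'M[C]_(m, n) :=
  map_mx (ev gamma) Phi.

(* Library matrices are indexed by ordinals, so matrices indexed by G are
   written along an enumeration [e : 'I_k -> G] of G (a bijection). *)

Section Enumeration.
Variables (k : nat) (e : 'I_k -> G).

(* The matrix of (T^g y)(g') = y(g' - g). *)
Definition transl (g : G) : 'M[C]_k := \matrix_(i, j) (e j == e i - g)%:R.

Definition filter_block (x : CG) : 'M[C]_k := \sum_g coef x g *: transl g.

(* Block indices follow the Kronecker product [*t]: row p of the i-th row of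
   blocks has index [mxtens_index (i, p)], that is i * k + p. *)
Definition filter_bank b v (Phi : 'M[CG]_(b, v)) : 'M[C]_(b * k, v * k) :=
  \matrix_(i, j) filter_block (Phi (mxtens_unindex i).1 (mxtens_unindex j).1)
                   (mxtens_unindex i).2 (mxtens_unindex j).2.

Definition kblock b v (Y : 'M[C]_(b * k, v * k)) (i : 'I_b) (j : 'I_v) :
    'M[C]_k :=
  \matrix_(p, q) Y (mxtens_index (i, p)) (mxtens_index (j, q)).

(* L(g', g'') = L(g' - g'', 0) *)
Definition circulant (L : 'M[C]_k) : Prop :=
  forall i j p q : 'I_k, e p = e i - e j -> e q = 0 -> L i j = L p q.

End Enumeration.
End Polyphase.

Section Designs.
Variable V : finType.
Implicit Types (B S : {set {set V}}) (K L : {set V}).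

Definition is_BIBD1 (v k : nat) B : Prop :=
  [/\ (2 <= k < v)%N,
      #|V| = v,
      forall K, K \in B -> #|K| = k
    & forall x y : V, x != y ->
        exists! K, [/\ K \in B, x \in K & y \in K]].

Definition is_GQ (s t : nat) B : Prop :=
  [/\ (0 < s)%N /\ (0 < t)%N,
      (forall K, K \in B -> #|K| = s.+1)
        /\ (forall x : V, #|[set K in B | x \in K]| = t.+1),
      forall K L, K \in B -> L \in B -> K != L -> (#|K :&: L| <= 1)%N,
      forall x y : V, x != y ->
        (#|[set K in B | (x \in K) && (y \in K)]| <= 1)%N
    & forall (x : V) K, K \in B -> x \notin K ->
        exists! p : V * {set V},
          [/\ p.2 \in B, p.1 \in K, p.1 \in p.2 & x \in p.2]].

Definition is_spread B S : Prop := S \subset B /\ partition S [set: V].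

End Designs.

(* The vertices are the column indices; [blk i] is the block of row i.  A
   family [blk] enumerates a set of blocks, so it is required to be injective
   below. *)
Definition incidence_mx (R : pzSemiRingType) m n (blk : 'I_m -> {set 'I_n}) :
    'M[R]_(m, n) :=
  \matrix_(i, j) (j \in blk i)%:R.

Definition BIBD1_incidence (R : pzSemiRingType) m n (v k : nat)
    (M : 'M[R]_(m, n)) : Prop :=
  exists blk : 'I_m -> {set 'I_n},
    [/\ injective blk, M = incidence_mx R blk
      & is_BIBD1 v k [set blk i | i : 'I_m]].

(* The first m1 rows correspond to a spread. *)
Definition GQ_spread_incidence (R : pzSemiRingType) m1 m2 n (s t : nat)
    (Z : 'M[R]_(m1 + m2, n)) : Prop :=
  exists blk : 'I_(m1 + m2) -> {set 'I_n},
    [/\ injective blk, Z = incidence_mx R blk,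
        is_GQ s t [set blk i | i : 'I_(m1 + m2)]
      & is_spread [set blk i | i : 'I_(m1 + m2)]
                  [set blk (lshift m2 i) | i : 'I_m1]].

Section Frames.
Variable C : numClosedFieldType.

Definition inner m (x y : 'cV[C]_m) : C := \sum_i (x i 0)^* * y i 0.

(* The columns of M form an ETF for their span. *)
Definition is_ETF m n (M : 'M[C]_(m, n)) : Prop :=
  [/\ forall i, col i M != 0,
      forall i j, inner (col i M) (col i M) = inner (col j M) (col j M),
      exists w : C, forall i j, i != j -> `|inner (col i M) (col j M)| = w
    & exists2 a : C, 0 < a
      & forall x : 'cV[C]_m, (x^T <= M^T)%MS ->
          \sum_i inner (col i M) x *: col i M = a *: x].

Definition is_real_ETF m n (M : 'M[C]_(m, n)) : Prop :=
  (forall i j, M i j \is Num.real) /\ is_ETF M.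

End Frames.

Section Main.
Variables (C : numClosedFieldType) (G : finZmodType).
Local Notation CG := (group_ring C G).

Definition polyphase_BIBD_ETF (v k f : nat) b (Phi : 'M[CG]_(b, v)) : Prop :=
  [/\ #|G| = f,
      forall i j, Phi i j = 0 \/ is_monomial (Phi i j),
      BIBD1_incidence v k (abs2 Phi)
    & forall gamma : G -> C, is_character gamma -> nontrivial gamma ->
        is_ETF (mxev gamma Phi)].

(* In the last clause the integers n - f c - 2, n - 1 and c are read in the
   group ring; n - f c - 2 may be negative. *)
Definition abelian_DRACKN (n f c : nat) (A : 'M[CG]_n) : Prop :=
  [/\ [/\ (0 < n)%N, (2 <= f)%N, (0 < c)%N & #|G| = f],
      padj A = A,
      forall i, A i i = 0,
      forall i j, i != j -> is_monomial (A i j)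
    & A *m A = (n%:R - (f * c)%:R - 2%:R) *: A + (n%:R - 1)%:M
               + (c%:R * all_ones C G) *: (const_mx 1 - 1%:M)].

Definition spread_stack v k m (Y : 'M[C]_(m, v * k)) :
    'M[C]_(v * 1 + m, v * k) :=
  col_mx (1%:M *t const_mx 1) Y.

End Main.

Arguments polyphase_BIBD_ETF {C G} v k f {b} Phi.
Arguments abelian_DRACKN {C G} n f c A.

(* Main.v *)
(* Write Phi^* Phi = t I + A, where A has zero diagonal and, since any two
   vertices lie in a single block, monomial entries off the diagonal.  If
   Phi(B, j) is a monomial, the (B, j) entry of Phi Phi^* Phi is
   (s + t) Phi(B, j).  If Phi(B, j) = 0, it is a sum of s + 1 monomials, and all
   parts of the theorem revolve around the condition ("coherence") that this sum
   be 1(z).  Its coefficient at z^(p - q) counts the points of the block (B, p)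
   that are joined to the point (j, q), so coherence is the quadrangle axiom.
   Evaluated at a nontrivial character it says that the entry vanishes, so
   coherence is Phi Phi^* Phi = (s + t) Phi at those characters, the tightness
   of the frames; conversely, an element of the group ring is determined by its
   values at the characters.  Multiplying by Phi^* gives the DRACKN equation. *)
Require Import Defs.
From mathcomp Require Import all_boot all_order all_algebra.
From mathcomp Require Import all_fingroup all_solvable all_field.
From mathcomp Require Import complex mxtens reals ring.

Set Implicit Arguments.
Unset Strict Implicit.
Unset Printing Implicit Defensive.

Import Order.TTheory GRing.Theory Num.Theory.
Local Open Scope ring_scope.

(** * Group rings and characters *)

Section GroupRingTheory.
Variables (C : comNzRingType) (G : finZmodType).
Local Notation CG := (group_ring C G).
Implicit Types (x y : CG) (g h : G).

Lemma group_ringP x y : (forall g, coef x g = coef y g) -> x = y.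
Proof. by move=> exy; apply/ffunP. Qed.

Lemma gcoef0 g : coef (0 : CG) g = 0.
Proof. by rewrite /coef ffunE. Qed.

Lemma gcoefD x y g : coef (x + y) g = coef x g + coef y g.
Proof. by rewrite /coef ffunE. Qed.

Lemma gcoef_sum I (r : seq I) (P : pred I) (F : I -> CG) g :
  coef (\sum_(i <- r | P i) F i) g = \sum_(i <- r | P i) coef (F i) g.
Proof. 
have fD : {morph (fun x : CG => coef x g) : x y / x + y}.
  by move=> x y; exact: gcoefD.
exact: (big_morph _ fD (gcoef0 g)).
Qed.

Lemma gcoef_monomial g h : coef (monomial C g) h = (h == g)%:R.
Proof. by rewrite /coef ffunE. Qed.

Lemma gcoefM x y g : coef (x * y) g = \sum_h coef x h * coef y (g - h).
Proof. exact: coef_conv. Qed.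

Lemma monomial0 : monomial C 0 = 1 :> CG.
Proof. by []. Qed.

Lemma monomial_eq g h : (monomial C g == monomial C h) = (g == h).
Proof.
apply/eqP/eqP => [/(congr1 (fun x : CG => coef x g))|-> //].
rewrite !gcoef_monomial eqxx; case: eqP => // _ /eqP.
by rewrite oner_eq0.
Qed.

Lemma monomial_neq0 g : monomial C g != 0 :> CG.
Proof.
apply/eqP => /(congr1 (fun x : CG => coef x g))/eqP.
by rewrite gcoef_monomial eqxx gcoef0 oner_eq0.
Qed.

Lemma gcoef_monomialM g x h : coef (monomial C g * x) h = coef x (h - g).
Proof.
rewrite gcoefM (bigD1 g) //= big1 ?addr0 => [|i /negPf ig].
  by rewrite gcoef_monomial eqxx mul1r.
by rewrite gcoef_monomial ig mul0r.
Qed.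

Lemma monomialD g h : monomial C (g + h) = monomial C g * monomial C h :> CG.
Proof.
apply: group_ringP => d; rewrite gcoef_monomialM !gcoef_monomial.
by rewrite subr_eq addrC.
Qed.

Lemma gcoef_all_ones g : coef (all_ones C G) g = 1.
Proof.
rewrite gcoef_sum (bigD1 g) //= big1 ?addr0 => [|i /negPf ig].
  by rewrite gcoef_monomial eqxx.
by rewrite gcoef_monomial eq_sym ig.
Qed.

Lemma all_onesM g : monomial C g * all_ones C G = all_ones C G.
Proof. by apply: group_ringP => h; rewrite gcoef_monomialM !gcoef_all_ones. Qed.

Lemma ev0 (gamma : G -> C) : ev gamma (0 : CG) = 0.
Proof. by apply: big1 => g _; rewrite gcoef0 mul0r. Qed.

Lemma evD (gamma : G -> C) x y : ev gamma (x + y) = ev gamma x + ev gamma y.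
Proof. by rewrite -big_split; apply: eq_bigr => g _; rewrite gcoefD mulrDl. Qed.

Lemma ev_sum (gamma : G -> C) I (r : seq I) (P : pred I) (F : I -> CG) :
  ev gamma (\sum_(i <- r | P i) F i) = \sum_(i <- r | P i) ev gamma (F i).
Proof. exact: (big_morph _ (evD gamma) (ev0 gamma)). Qed.

Lemma ev_monomial (gamma : G -> C) g : ev gamma (monomial C g) = gamma g.
Proof.
rewrite /ev (bigD1 g) //= big1 ?addr0 => [|i /negPf ig].
  by rewrite gcoef_monomial eqxx mul1r.
by rewrite gcoef_monomial ig mul0r.
Qed.

Section Multiplicative.
Variable gamma : G -> C.
Hypothesis gammaD : forall g h, gamma (g + h) = gamma g * gamma h.

Lemma evM x y : ev gamma (x * y) = ev gamma x * ev gamma y.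
Proof.
rewrite /ev mulr_suml.
under eq_bigr do rewrite gcoefM mulr_suml.
rewrite exchange_big; apply: eq_bigr => h _ /=.
rewrite mulr_sumr (reindex_inj (addIr h)) /=; apply: eq_bigr => g _.
by rewrite addrK gammaD (mulrC (gamma g)) mulrACA.
Qed.

Lemma mxevM m n p (A : 'M[CG]_(m, n)) (B : 'M[CG]_(n, p)) :
  map_mx (ev gamma) (A *m B) = map_mx (ev gamma) A *m map_mx (ev gamma) B.
Proof.
apply/matrixP => i j; rewrite !mxE ev_sum.
by apply: eq_bigr => l _; rewrite !mxE evM.
Qed.

End Multiplicative.

End GroupRingTheory.

Section RegularRepresentation.
Variables (C : numClosedFieldType) (G : finZmodType) (k : nat).
Variable e : 'I_k -> G.
Hypothesis e_bij : bijective e.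
Local Notation CG := (group_ring C G).

Lemma filter_blockE (x : CG) i j : filter_block e x i j = coef x (e i - e j).
Proof.
rewrite /filter_block summxE (bigD1 (e i - e j)) //= big1 ?addr0 => [|g].
  by rewrite !mxE subKr eqxx mulr1.
rewrite !mxE => ne; rewrite (_ : (_ == _) = false) ?mulr0 //.
by apply: contra_neqF ne => /eqP ->; rewrite subKr.
Qed.

Lemma filter_block_inj : injective (@filter_block C G k e).
Proof.
move=> x y Exy; apply: group_ringP => g.
have [f _ eK] := e_bij.
have -> : g = e (f g) - e (f 0) by rewrite !eK subr0.
by rewrite -!filter_blockE Exy.
Qed.

Lemma filter_blockM (x y : CG) :
  filter_block e (x * y) = filter_block e x *m filter_block e y.
Proof.
apply/matrixP => i j; rewrite mxE filter_blockE gcoefM.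
have bij_sub : bijective (fun l : 'I_k => e i - e l).
  by apply: (@bij_comp _ _ _ (fun g => e i - g)) => //; apply/inv_bij/subKr.
rewrite (reindex _ (onW_bij _ bij_sub)); apply: eq_bigr => l _ /=.
by rewrite !filter_blockE opprB [e i - _ + _]addrC addrA subrK.
Qed.

Lemma filter_block1 : filter_block e (1 : CG) = 1%:M.
Proof.
apply/matrixP => i j; rewrite filter_blockE -monomial0 gcoef_monomial mxE.
by rewrite subr_eq0 (bij_eq e_bij).
Qed.

End RegularRepresentation.

(** * Characters and Fourier inversion *)

Section Characters.
Variables (C : numClosedFieldType) (G : finZmodType).
Local Notation CG := (group_ring C G).

Lemma char0 (gamma : G -> C) : is_character gamma -> gamma 0 = 1.
Proof.
case=> gD gN; have nz : gamma 0 != 0 by rewrite -normr_eq0 gN oner_eq0.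
by apply: (mulfI nz); rewrite -gD addr0 mulr1.
Qed.

Lemma charN (gamma : G -> C) g :
  is_character gamma -> gamma (- g) = (gamma g)^*.
Proof.
move=> g_char; have [gD gN] := g_char.
have nz : gamma g != 0 by rewrite -normr_eq0 gN oner_eq0.
apply: (mulfI nz); rewrite -gD subrr char0 //.
by rewrite -normCK gN expr1n.
Qed.

(** The minimal polynomial divides [X^m - 1], which has simple roots because [m] is nonzero in
    [C]. *)
Lemma diagonalizable_unity_root n (A : 'M[C]_n.+1) m :
  (0 < m)%N -> A ^+ m = 1 -> mxpoly.diagonalizable A.
Proof.
move=> m_gt0 Am; apply/mxpoly.diagonalizableP.
have [rs Drs] := closed_field_poly_normal ('X^m - 1 : {poly C}).
move: Drs; rewrite (monicP (monic_Xn_sub_1 _ m_gt0)) scale1r => Drs.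
exists rs.
  rewrite -separable_prod_XsubC -Drs separable_Xn_sub_1 //.
  by rewrite pnatr_eq0 -lt0n.
rewrite -Drs; apply: mxminpoly_min.
by rewrite rmorphB rmorphXn /= horner_mx_X rmorph1 Am subrr.
Qed.

(* The translations are commuting matrices of finite order, so they are
   diagonal in a common basis, and each diagonal position yields a character. *)
Lemma characters_separate (x : CG) :
  (forall gamma : G -> C, is_character gamma -> ev gamma x = 0) -> x = 0.
Proof.
move=> x0.
have [n Gn] : exists n, #|G| = n.+1.
  by exists #|G|.-1; rewrite prednK //; apply/card_gt0P; exists 0.
pose e (i : 'I_n.+1) : G := enum_val (cast_ord (esym Gn) i).
have e_bij : bijective e.
  apply: bij_comp; first exact: enum_val_bij.
  by exists (cast_ord Gn) => i; rewrite ?cast_ordK ?cast_ordKV.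
pose T g : 'M[C]_n.+1 := filter_block e (monomial C g).
have TD g h : T (g + h) = T g *m T h by rewrite /T monomialD filter_blockM.
have T0 : T 0 = 1%:M by rewrite /T monomial0 filter_block1.
have TX g m : T (g *+ m) = T g ^+ m.
  by elim: m => [|m IH]; rewrite ?T0 // mulrS exprS TD IH.
have TG g : T g ^+ #|G| = 1.
  rewrite -TX -FinRing.zmodXgE; have := expg_cardG (in_setT g).
  by rewrite cardsT => ->.
have [|P Punit /allP/= diagP] :=
    (mxpoly.codiagonalizableP [seq T g | g <- enum G]).1.
  split=> [_ _ /mapP[g _ ->] /mapP[h _ ->]|_ /mapP[g _ ->]].
    by rewrite /comm_mx -!TD addrC.
  by apply: (@diagonalizable_unity_root _ _ #|G|) => //; rewrite Gn.
pose D g := P *m T g *m invmx P.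
have Ddiag g i j : i != j -> D g i j = 0.
  move=> ij; apply: (mxpoly.diagonalizable_forP _ Punit _ i j ij).
  by apply: diagP; apply: map_f; rewrite mem_enum.
have DD g h : D (g + h) = D g *m D h.
  by rewrite /D TD !mulmxA mulmxKV.
have DDii g h i : D (g + h) i i = D g i i * D h i i.
  rewrite DD mxE (bigD1 i) //= big1 ?addr0 // => j ji.
  by rewrite Ddiag ?mul0r // eq_sym.
have D0 : D 0 = 1%:M by rewrite /D T0 mulmx1 mulmxV.
have Dchar i : is_character (fun g => D g i i).
  split=> [g h|g]; first exact: DDii.
  have Dn m : D (g *+ m) i i = D g i i ^+ m.
    elim: m => [|m IH]; last by rewrite mulrS exprS DDii IH.
    by rewrite mulr0n D0 mxE eqxx.
  (* A root of unity has modulus 1. *)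
  have : `|D g i i| ^+ #|G| = 1.
    rewrite -normrX -Dn -FinRing.zmodXgE; have := expg_cardG (in_setT g).
    by rewrite cardsT => ->; rewrite D0 mxE eqxx normr1.
  by move/eqP; rewrite Gn pexpr_eq1 // => /eqP.
(* In the common eigenbasis [x] acts diagonally, and its [i]-th eigenvalue is its value at the
   [i]-th character. *)
have Dx : P *m filter_block e x *m invmx P = \sum_g coef x g *: D g.
  rewrite (_ : filter_block e x = \sum_g coef x g *: T g).
    rewrite mulmx_sumr mulmx_suml; apply: eq_bigr => g _.
    by rewrite -scalemxAr -scalemxAl.
  apply/matrixP => i j; rewrite filter_blockE summxE.
  rewrite (bigD1 (e i - e j)) //= big1 => [|g /negPf ne].
    by rewrite mxE filter_blockE gcoef_monomial eqxx mulr1 addr0.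
  by rewrite mxE filter_blockE gcoef_monomial eq_sym ne mulr0.
apply: (filter_block_inj e_bij).
have -> : filter_block e (0 : CG) = 0.
  by apply/matrixP => i j; rewrite filter_blockE gcoef0 mxE.
suff Z : P *m filter_block e x *m invmx P = 0.
  have <- : invmx P *m (P *m filter_block e x *m invmx P) *m P =
      filter_block e x.
    by rewrite !mulmxA mulmxKV // mulVmx // mul1mx.
  by rewrite Z mulmx0 mul0mx.
rewrite Dx; apply/matrixP => i j; rewrite summxE mxE.
have [<-|ij] := eqVneq i j.
  by rewrite -[RHS](x0 _ (Dchar i)); apply: eq_bigr => g _; rewrite mxE.
by apply: big1 => g _; rewrite mxE Ddiag ?mulr0.
Qed.

(** Multiplying the sum by [gamma h] permutes its terms, so a value [gamma h] other than 1 forces it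
    to vanish. *)
Lemma sum_nontrivial_character (gamma : G -> C) :
  is_character gamma -> nontrivial gamma -> \sum_g gamma g = 0.
Proof.
move=> [gD gN] [h h1].
suff /eqP : (gamma h - 1) * \sum_g gamma g = 0.
  by rewrite mulf_eq0 subr_eq0 (negPf h1) => /eqP.
rewrite mulrBl mul1r mulr_sumr; apply/eqP; rewrite subr_eq0; apply/eqP.
rewrite [RHS](reindex_inj (addrI h)) /=.
by apply: eq_bigr => g _; rewrite gD.
Qed.

Lemma ev_all_ones (gamma : G -> C) :
  is_character gamma -> nontrivial gamma -> ev gamma (all_ones C G) = 0.
Proof.
move=> g_char g_nt; rewrite -[RHS](sum_nontrivial_character g_char g_nt).
by apply: eq_bigr => g _; rewrite gcoef_all_ones mul1r.
Qed.

(** By [characters_separate] it suffices to compare values. Both sides vanish at nontrivial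
    characters; at the trivial one the value is the coefficient sum, [#|G|] for both. *)
Lemma all_onesP (x : CG) :
  (forall gamma : G -> C, is_character gamma -> nontrivial gamma ->
     ev gamma x = 0) ->
  \sum_g coef x g = #|G|%:R -> x = all_ones C G.
Proof.
move=> x_nt x_t; apply/eqP; rewrite -subr_eq0; apply/eqP.
apply: characters_separate => gamma g_char.
have evB : ev gamma (x - all_ones C G) = ev gamma x - ev gamma (all_ones C G).
  apply/eqP; rewrite eq_sym subr_eq -evD subrK //.
rewrite evB; have [/existsP g_nt|] := boolP [exists g, gamma g != 1].
  by rewrite x_nt // ev_all_ones // subrr.
rewrite negb_exists => /forallP g_t.
apply/eqP; rewrite subr_eq0; apply/eqP.
have g1 g : gamma g = 1 by apply/eqP; have := g_t g; rewrite negbK.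
rewrite /ev; under eq_bigr do rewrite g1 mulr1.
rewrite x_t; under [RHS]eq_bigr do rewrite gcoef_all_ones g1 mulr1.
by rewrite sumr_const.
Qed.

(** Otherwise nontrivial characters have nontrivial squares, since a character with trivial square
    takes only the values 1 and -1. Then the sum of all [z^(g + g)] equals 1(z) by [all_onesP]. But
    its coefficient at 0 counts the solutions of [g + g = 0], and Cauchy's theorem provides one
    besides 0. *)
Lemma real_nontrivial_character :
  ~~ odd #|G| ->
  exists gamma : G -> C,
    [/\ is_character gamma, nontrivial gamma & forall g, gamma g \is Num.real].
Proof.
move=> Geven; apply: boolp.contrapT => no_real.
have sq_nt (gamma : G -> C) : is_character gamma -> nontrivial gamma ->
    ev gamma (\sum_(g : G) monomial C (g + g)) = 0.
  move=> g_char g_nt; have [gD gN] := g_char.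
  rewrite ev_sum; under eq_bigr do rewrite ev_monomial gD.
  apply: (@sum_nontrivial_character (fun g => gamma g * gamma g)).
    by split=> [g h|g]; rewrite ?gD ?normrM ?gN ?mulr1 // mulrACA.
  apply: boolp.contrapT => sq_t; apply: no_real; exists gamma; split=> // g.
  have /eqP : gamma g ^+ 2 = 1.
    by apply/eqP/negPn/negP => g2; apply: sq_t; exists g; rewrite -expr2.
  by rewrite sqrf_eq1 => /orP[]/eqP->; rewrite ?rpredN rpred1.
have sum_coef : \sum_(h : G) coef (\sum_(g : G) monomial C (g + g)) h = #|G|%:R.
  under eq_bigr do rewrite gcoef_sum.
  rewrite exchange_big /= -sum1_card natr_sum; apply: eq_bigr => g _.
  rewrite (bigD1 (g + g)) //= gcoef_monomial eqxx big1 ?addr0 // => h /negPf h_g.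
  by rewrite gcoef_monomial h_g.
have [h _ h2] : {h : G | h \in [set: G] & #[h]%g = 2}.
  by apply: Cauchy; rewrite // cardsT dvdn2.
have h0 : h != 0 by apply/eqP => h0; move: h2; rewrite h0 order1.
have hh : h + h = 0 by have := expg_order h; rewrite h2.
have /(congr1 (fun x => coef x 0)) := all_onesP sq_nt sum_coef.
rewrite gcoef_all_ones gcoef_sum; under eq_bigr do rewrite gcoef_monomial.
rewrite -natr_sum; apply/eqP; rewrite pnatr_eq1.
by rewrite (bigD1 0) //= (bigD1 h) //= hh addr0 !eqxx.
Qed.

End Characters.

(** * Tight frames and polyphase designs *)

Section Frames.
Variable C : numClosedFieldType.

Definition adjmx m n (M : 'M[C]_(m, n)) : 'M[C]_(n, m) := (map_mx Num.conj M)^T.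

Lemma inner_col m n (M : 'M[C]_(m, n)) i j :
  inner (col i M) (col j M) = (adjmx M *m M) i j.
Proof. by rewrite mxE; apply: eq_bigr => l _; rewrite !mxE. Qed.

Lemma frame_operatorE m n (M : 'M[C]_(m, n)) (x : 'cV[C]_m) :
  \sum_i inner (col i M) x *: col i M = M *m (adjmx M *m x).
Proof.
apply/matrixP => i j; rewrite ord1 summxE mxE; apply: eq_bigr => l _.
rewrite !mxE mulrC; congr (_ * _).
by apply: eq_bigr => p _; rewrite !mxE.
Qed.

(** The frame operator is [M M^*], and it suffices to test it on the columns of [M], which span. Row
    spaces of transposes stand for column spaces. *)
Lemma tight_frameP m n (M : 'M[C]_(m, n)) (a : C) :
  (forall x : 'cV[C]_m, (x^T <= M^T)%MS ->
     \sum_i inner (col i M) x *: col i M = a *: x) <->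
  M *m (adjmx M *m M) = a *: M.
Proof.
split=> [tight | eqM x /submxP[D Dx]].
  apply/matrixP => i j.
  have /matrixP/(_ i 0) : M *m (adjmx M *m col j M) = a *: col j M.
    by rewrite -frame_operatorE tight // tr_col row_sub.
  by rewrite !colE !mulmxA -colE mxE -!mulmxA => ->; rewrite -colE !mxE.
have -> : x = M *m D^T by rewrite -[x]trmxK Dx trmx_mul trmxK.
by rewrite frame_operatorE !mulmxA -[M *m _ *m M]mulmxA eqM scalemxAl.
Qed.

(** In a full-rank factorization [P = L U], cancelling [L] and [U] in [L U L U = L U] leaves
    [U L = 1], an identity matrix of size the rank, with the same trace as [L U]. *)
Lemma mxrank_idempotent n (P : 'M[C]_n) :
  P *m P = P -> (\rank P)%:R = \tr P.
Proof.
move=> PP; move: (row_base_free P) (col_base_full P) (mulmx_base P).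
move: (row_base P) (col_base P) => U L Ufree Lfull PE.
have inv : U *m L = 1%:M.
  apply: (row_free_inj Ufree); apply: (row_full_inj Lfull).
  by rewrite /= mul1mx !mulmxA PE -mulmxA PE PP.
by rewrite -[in RHS]PE mxtrace_mulC inv mxtrace1.
Qed.

(** The Gram matrix divided by [a] is idempotent and has the rank of [M], so its trace is that
    rank. *)
Lemma tight_frame_rank m n (M : 'M[C]_(m, n)) (a : C) :
  a != 0 -> M *m (adjmx M *m M) = a *: M ->
  a * (\rank M)%:R = \tr (adjmx M *m M).
Proof.
move=> a0 eqM; set S := adjmx M *m M.
have rankS : \rank M = \rank (a^-1 *: S).
  rewrite mxrank_scale_nz ?invr_eq0 //; apply/eqP.
  rewrite eqn_leq mxrankM_maxr andbT.
  by rewrite -(mxrank_scale_nz _ a0) -eqM mxrankM_maxr.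
have idem : (a^-1 *: S) *m (a^-1 *: S) = a^-1 *: S.
  rewrite -scalemxAl -scalemxAr {1}/S -mulmxA eqM -scalemxAr !scalerA.
  by rewrite mulVf // mulr1.
by rewrite rankS mxrank_idempotent // mxtraceZ mulrA divff // mul1r.
Qed.

End Frames.

(** * Polyphase designs and their Gram matrices *)

Section PolyphaseDesign.
Variables (C : numClosedFieldType) (G : finZmodType).
Local Notation CG := (group_ring C G).

Lemma gconj0 : gconj (0 : CG) = 0.
Proof. by apply/ffunP => g; rewrite !ffunE gcoef0 conjC0. Qed.

Lemma gconj_monomial (g : G) : gconj (monomial C g) = monomial C (- g).
Proof.
by apply/ffunP => h; rewrite !ffunE gcoef_monomial conjC_nat eqr_oppLR.
Qed.

Lemma gcoef_gconj (x : CG) g : coef (gconj x) g = (coef x (- g))^*.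
Proof. by rewrite /coef ffunE. Qed.

Lemma gconjD (x y : CG) : gconj (x + y) = gconj x + gconj y.
Proof.
by apply: group_ringP => g; rewrite gcoefD !gcoef_gconj gcoefD rmorphD.
Qed.

Lemma gconjK : involutive (@gconj C G).
Proof.
by move=> x; apply: group_ringP => g; rewrite !gcoef_gconj opprK conjCK.
Qed.

Lemma gconjM (x y : CG) : gconj (x * y) = gconj x * gconj y.
Proof.
apply: group_ringP => g; rewrite gcoef_gconj !gcoefM rmorph_sum /=.
rewrite (reindex_inj oppr_inj) /=; apply: eq_bigr => h _.
by rewrite !gcoef_gconj rmorphM /= opprB opprK addrC.
Qed.

Lemma ev_gconj (gamma : G -> C) (x : CG) :
  is_character gamma -> ev gamma (gconj x) = (ev gamma x)^*.
Proof.
move=> g_char; rewrite /ev rmorph_sum /= (reindex_inj oppr_inj) /=.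
apply: eq_bigr => g _.
by rewrite gcoef_gconj opprK rmorphM /= charN.
Qed.

Lemma mxev_padj (gamma : G -> C) m n (A : 'M[CG]_(m, n)) :
  is_character gamma -> mxev gamma (padj A) = adjmx (mxev gamma A).
Proof. by move=> g_char; apply/matrixP => i j; rewrite !mxE ev_gconj. Qed.

Definition monomial_or0 (x : CG) : Prop := x = 0 \/ is_monomial x.

Lemma gconj_mul_monomial (x : CG) :
  monomial_or0 x -> gconj x * x = (x != 0)%:R.
Proof.
case=> [->|[g ->]]; first by rewrite mulr0 eqxx.
by rewrite gconj_monomial -monomialD addNr monomial_neq0.
Qed.

Lemma gcoef_monomial_or0 (x : CG) d :
  monomial_or0 x -> coef x d = (x == monomial C d)%:R.
Proof.
case=> [->|[g ->]]; first by rewrite gcoef0 eq_sym (negPf (monomial_neq0 _ _)).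
by rewrite gcoef_monomial monomial_eq eq_sym.
Qed.

Lemma monomial_or0M (x y : CG) :
  monomial_or0 x -> monomial_or0 y -> monomial_or0 (x * y).
Proof.
move=> [->|[g ->]]; first by left; rewrite mul0r.
move=> [->|[h ->]]; first by left; rewrite mulr0.
by right; exists (g + h); rewrite monomialD.
Qed.

Lemma monomial_or0_gconj (x : CG) : monomial_or0 x -> monomial_or0 (gconj x).
Proof.
move=> [->|[g ->]]; first by left; rewrite gconj0.
by right; exists (- g); rewrite gconj_monomial.
Qed.

Lemma all_ones_gconj_monomial (x : CG) :
  monomial_or0 x -> gconj x * all_ones C G = (x != 0)%:R * all_ones C G.
Proof.
case=> [->|[g ->]]; first by rewrite gconj0 eqxx !mul0r.
by rewrite gconj_monomial all_onesM monomial_neq0 mul1r.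
Qed.

Lemma ev1_monomial (x : CG) :
  monomial_or0 x -> ev (fun=> 1) x = (x != 0)%:R.
Proof.
case=> [->|[g ->]]; first by rewrite ev0 eqxx.
by rewrite ev_monomial monomial_neq0.
Qed.

Variables (b v : nat) (Phi : 'M[CG]_(b, v)) (s t : nat).

(** The design is read off the zero pattern of [Phi]. A vertex lies on [t] of its blocks; the spread
    will supply one more, as a quadrangle requires. *)
Definition polyphase_design : Prop :=
  [/\ forall B j, monomial_or0 (Phi B j),
      forall B, (\sum_j (Phi B j != 0)%R = s.+1)%N,
      forall j, (\sum_B (Phi B j != 0)%R = t)%N
    & forall i j, i != j -> exists! B, Phi B i != 0 /\ Phi B j != 0].

Definition coherent : Prop :=
  forall B j, Phi B j = 0 ->
    (Phi *m (padj Phi *m Phi)) B j = all_ones C G.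

Hypothesis designP : polyphase_design.

Let Phi_mono B j : monomial_or0 (Phi B j).
Proof. by case: designP. Qed.

Lemma gramE i j :
  (padj Phi *m Phi) i j = \sum_B gconj (Phi B i) * Phi B j.
Proof. by rewrite mxE; apply: eq_bigr => B _; rewrite !mxE. Qed.

Lemma gram_diag i : (padj Phi *m Phi) i i = t%:R.
Proof.
have [_ _ /(_ i) <- _] := designP; rewrite gramE natr_sum.
by apply: eq_bigr => B _; rewrite gconj_mul_monomial.
Qed.

Lemma gram_offdiag i j B : i != j -> Phi B i != 0 -> Phi B j != 0 ->
  (padj Phi *m Phi) i j = gconj (Phi B i) * Phi B j.
Proof.
move=> ij Bi Bj; have [_ _ _ /(_ i j ij)[B0 [_ B0u]]] := designP.
rewrite gramE (bigD1 B) //= big1 ?addr0 // => B' B'B.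
have [->|B'i] := eqVneq (Phi B' i) 0; first by rewrite gconj0 mul0r.
have [->|B'j] := eqVneq (Phi B' j) 0; first by rewrite mulr0.
by case/eqP: B'B; rewrite -(B0u B) // -(B0u B').
Qed.

Lemma gram_monomial i j : i != j -> is_monomial ((padj Phi *m Phi) i j).
Proof.
move=> ij; have [_ _ _ /(_ i j ij)[B [[Bi Bj] _]]] := designP.
rewrite (gram_offdiag ij Bi Bj).
have [|[g ->]] := Phi_mono B i; first by move/eqP: Bi.
have [|[h ->]] := Phi_mono B j; first by move/eqP: Bj.
by exists (- g + h); rewrite gconj_monomial monomialD.
Qed.

(** The term [i = j] contributes [t]. For each of the other [s] vertices [i] of [B], the block
    joining [i] to [j] is [B] itself, so the term is [Phi B i * gconj (Phi B i) * Phi B j], which is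
    [Phi B j]. *)
Lemma row_mul_gram B j : Phi B j != 0 ->
  (Phi *m (padj Phi *m Phi)) B j = (s + t)%:R * Phi B j.
Proof.
move=> Bj; have [_ rowB _ _] := designP.
rewrite mxE (bigD1 j) //= gram_diag natrD mulrDl addrC.
congr (_ + _); last exact: mulrC.
have -> : s%:R = \sum_(i | i != j) (Phi B i != 0)%:R :> CG.
  have := rowB B; rewrite (bigD1 j) //= Bj => /eqP.
  by rewrite eqSS => /eqP <-; rewrite natr_sum.
rewrite mulr_suml; apply: eq_bigr => i ij.
have [Bi0|Bi] := eqVneq (Phi B i) 0; first by rewrite Bi0 !mul0r.
by rewrite (gram_offdiag ij Bi Bj) mulrCA mulrA gconj_mul_monomial ?Bi //.
Qed.

(** The terms of the expanded triple product are monomials or zero, so a coefficient counts them. A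
    nonzero term is a path from [B] through the vertex [p.1] and the block [p.2] to [j]. *)
Lemma coef_row_mul_gram B j d :
  coef ((Phi *m (padj Phi *m Phi)) B j) d =
  #|[set p : 'I_v * 'I_b |
      Phi B p.1 * (gconj (Phi p.2 p.1) * Phi p.2 j) == monomial C d]|%:R.
Proof.
rewrite mxE; under eq_bigr do rewrite gramE mulr_sumr.
rewrite pair_big gcoef_sum -sum1_card natr_sum big_mkcond /= [RHS]big_mkcond.
apply: eq_bigr => p _; rewrite inE gcoef_monomial_or0; first by case: ifP.
by apply: monomial_or0M => //; apply: monomial_or0M => //;
   apply: monomial_or0_gconj.
Qed.

(** The coefficient sum is the value at the trivial character. Each of the [s + 1] vertices of [B]
    differs from [j], so its Gram entry is a monomial and its term has value 1. *)
Lemma sum_coef_row_mul_gram B j : Phi B j = 0 ->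
  \sum_g coef ((Phi *m (padj Phi *m Phi)) B j) g = s.+1%:R.
Proof.
move=> Bj; have [_ rowB _ _] := designP.
have evE (x : CG) : \sum_g coef x g = ev (fun=> 1) x.
  by apply: eq_bigr => g _; rewrite mulr1.
rewrite evE mxE ev_sum -(rowB B) natr_sum; apply: eq_bigr => i _.
rewrite evM ?(ev1_monomial (Phi_mono B i)); last by move=> *; rewrite mulr1.
have [Bi0|Bi] := eqVneq (Phi B i) 0; first by rewrite mul0r.
have ij : i != j by apply: contra_neq Bi => ->.
by have [g ->] := gram_monomial ij; rewrite ev_monomial mulr1.
Qed.

Lemma row_mul_gramE : coherent ->
  Phi *m (padj Phi *m Phi) =
  (s + t)%:R *: Phi + all_ones C G *: \matrix_(B, j) (Phi B j == 0)%:R.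
Proof.
move=> coh; apply/matrixP => B j.
have [Bj|Bj] := eqVneq (Phi B j) 0.
  by rewrite coh // !mxE Bj eqxx mulr0 mulr1 add0r.
by rewrite row_mul_gram // !mxE (negPf Bj) mulr0 addr0.
Qed.

(** Multiply [row_mul_gramE] by [padj Phi]. As 1(z) absorbs monomials, the last term has entries
    1(z) times the number of blocks that contain [i] but not [j], which is 0 if [i = j] and [t - 1]
    otherwise. *)
Lemma gram_mul_gram : coherent ->
  (padj Phi *m Phi) *m (padj Phi *m Phi) =
  (s + t)%:R *: (padj Phi *m Phi)
  + ((t%:R - 1) * all_ones C G) *: (const_mx 1 - 1%:M).
Proof.
move=> coh; rewrite -mulmxA row_mul_gramE // mulmxDr -!scalemxAr; congr (_ + _).
apply/matrixP => i j; rewrite !mxE mulr_sumr.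
have sum_pair : \sum_B (Phi B i != 0)%:R * (Phi B j != 0)%:R =
    (if i == j then t%:R else 1) :> CG.
  have [_ _ colj pairs] := designP.
  have [<-|/pairs[B [[Bi Bj] B_uniq]]] := eqVneq i j.
    rewrite -(colj i) natr_sum; apply: eq_bigr => B _.
    by rewrite -natrM mulnb andbb.
  rewrite (bigD1 B) //= Bi Bj mulr1 big1 ?addr0 // => B' B'B.
  rewrite -natrM mulnb; case: andP => // -[B'i B'j].
  by case/eqP: B'B; rewrite (B_uniq B').
transitivity (all_ones C G *
    (t%:R - \sum_B (Phi B i != 0)%:R * (Phi B j != 0)%:R)).
  have [_ _ /(_ i) <- _] := designP.
  rewrite natr_sum -sumrB mulr_sumr; apply: eq_bigr => B _.
  rewrite !mxE mulrCA mulrA all_ones_gconj_monomial // [_ * all_ones _ _]mulrC.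
  rewrite -mulrA; congr (_ * _).
  by case: (Phi B j == 0); rewrite ?mulr0 ?mulr1 ?subr0 ?subrr.
rewrite sum_pair; case: eqP => _; rewrite ?mulr1n ?mulr0n ?subrr ?subr0 ?mulr0 //.
by rewrite mulr1 mulrC.
Qed.

End PolyphaseDesign.

(** This passes from the equation of the Gram matrix to that of the DRACKN: apart from [K], the
    roots [s + t] and 0 become [s] and [-t]. *)
Lemma mulmx_shift (R : comNzRingType) n (W K : 'M[R]_n) (s t : R) :
  W *m W = (s + t) *: W + K ->
  (W - t%:M) *m (W - t%:M) = (s - t) *: (W - t%:M) + (s * t)%:M + K.
Proof.
move=> WW; rewrite mulmxBl !mulmxBr WW mul_scalar_mx mul_mx_scalar.
rewrite mul_scalar_mx -[(s * t)%:M]scalemx1 -[t%:M]scalemx1.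
apply/matrixP => i j; rewrite !mxE; move: (_ *+ _) => d; ring.
Qed.

(** * Coherence, equiangular tight frames and DRACKNs *)

Section DesignETF.
Variables (C : numClosedFieldType) (G : finZmodType).
Local Notation CG := (group_ring C G).
Variables (b v : nat) (Phi : 'M[CG]_(b, v)) (s t : nat).

Lemma mxev_gram (gamma : G -> C) : is_character gamma ->
  mxev gamma (padj Phi *m Phi) = adjmx (mxev gamma Phi) *m mxev gamma Phi.
Proof.
by move=> g_char; rewrite -mxev_padj //; apply: mxevM; case: g_char.
Qed.

Lemma mxev_row_mul_gram (gamma : G -> C) : is_character gamma ->
  mxev gamma (Phi *m (padj Phi *m Phi)) =
  mxev gamma Phi *m (adjmx (mxev gamma Phi) *m mxev gamma Phi).
Proof.
by move=> g_char; rewrite -mxev_gram //; apply: mxevM; case: g_char.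
Qed.

Hypothesis designP : polyphase_design Phi s t.

(** At a zero entry of [Phi] the tightness identity has right side 0 whatever the frame constant, so
    the entry of [Phi Phi^* Phi] vanishes at nontrivial characters. Its coefficient sum [s + 1] is
    the order of the group, and [all_onesP] applies. *)
Lemma ETF_coherent :
  #|G| = s.+1 ->
  (forall gamma : G -> C, is_character gamma -> nontrivial gamma ->
     is_ETF (mxev gamma Phi)) ->
  coherent Phi.
Proof.
move=> Gs etf B j Bj; apply: all_onesP; last first.
  by rewrite (sum_coef_row_mul_gram designP Bj) Gs.
move=> gamma g_char g_nt.
have [_ _ _ [a _ /tight_frameP/matrixP/(_ B j)]] := etf gamma g_char g_nt.
by rewrite -mxev_row_mul_gram // !mxE Bj ev0 mulr0.
Qed.

Lemma coherent_tight (gamma : G -> C) :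
  coherent Phi -> is_character gamma -> nontrivial gamma ->
  mxev gamma Phi *m (adjmx (mxev gamma Phi) *m mxev gamma Phi) =
  (s + t)%:R *: mxev gamma Phi.
Proof.
move=> coh g_char g_nt; rewrite -mxev_row_mul_gram //.
apply/matrixP => B j; rewrite [LHS]mxE [RHS]mxE [X in _ * X]mxE.
have [Bj|Bj] := eqVneq (Phi B j) 0.
  by rewrite coh // ev_all_ones // Bj ev0 mulr0.
rewrite (row_mul_gram designP Bj) mulr_natl.
elim: (s + t)%N => [|n IH]; first by rewrite mulr0n ev0 mul0r.
by rewrite mulrSr evD IH mulrSr mulrDl mul1r.
Qed.

Lemma mxev_gram_diag (gamma : G -> C) i : is_character gamma ->
  (adjmx (mxev gamma Phi) *m mxev gamma Phi) i i = t%:R.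
Proof.
move=> g_char; rewrite -mxev_gram // mxE (gram_diag designP).
elim: t => [|n IH]; first by rewrite mulr0n ev0.
rewrite mulrSr evD IH mulrSr -monomial0 ev_monomial char0 //.
Qed.

Lemma coherent_ETF (gamma : G -> C) :
  (0 < t)%N -> coherent Phi -> is_character gamma -> nontrivial gamma ->
  is_ETF (mxev gamma Phi).
Proof.
move=> t_gt0 coh g_char g_nt.
have norm_t i : inner (col i (mxev gamma Phi)) (col i (mxev gamma Phi)) = t%:R.
  by rewrite inner_col mxev_gram_diag.
split=> [i|i j||].
- apply: contraTneq t_gt0 => i0; move: (norm_t i); rewrite i0 /inner.
  rewrite big1 => [/esym/eqP|l _]; last by rewrite mxE mulr0.
  by rewrite pnatr_eq0 => /eqP->.
- by rewrite !norm_t.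
- exists 1 => i j ij; rewrite inner_col -mxev_gram // mxE.
  have [g ->] := gram_monomial designP ij.
  by rewrite ev_monomial; case: g_char.
exists (s + t)%:R; first by rewrite ltr0n addn_gt0 t_gt0 orbT.
by apply/tight_frameP; apply: coherent_tight.
Qed.

(** The Gram matrix has constant diagonal [t], hence trace [v t], and the frame constant is
    [s + t]. *)
Lemma coherent_rank (gamma : G -> C) :
  (0 < t)%N -> coherent Phi -> is_character gamma -> nontrivial gamma ->
  ((s + t) * \rank (mxev gamma Phi) = v * t)%N.
Proof.
move=> t_gt0 coh g_char g_nt.
have st0 : (s + t)%:R != 0 :> C.
  by rewrite pnatr_eq0 addn_eq0 negb_and -!lt0n t_gt0 orbT.
have := tight_frame_rank st0 (coherent_tight coh g_char g_nt).
rewrite /mxtrace; under eq_bigr do rewrite mxev_gram_diag //.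
rewrite sumr_const card_ord -mulrnA -natrM => /eqP.
by rewrite eqr_nat [(t * v)%N]mulnC => /eqP.
Qed.

Lemma coherent_DRACKN :
  v = (s * t + 1)%N -> (0 < s)%N -> (1 < t)%N -> #|G| = s.+1 ->
  coherent Phi ->
  abelian_DRACKN v s.+1 (t - 1) (padj Phi *m Phi - t%:R%:M).
Proof.
move=> Dv s_gt0 t_gt1 Gs coh; set W := padj Phi *m Phi.
have AE i j : (W - t%:R%:M) i j = if i == j then 0 else W i j.
  rewrite /W mxE [X in _ + X]mxE [X in - X]mxE.
  by have [<-|] := eqVneq i j; rewrite ?subr0 // (gram_diag designP) subrr.
have WC i j : gconj (W j i) = W i j.
  rewrite /W !gramE (big_morph _ (@gconjD C G) (@gconj0 C G)).
  by apply: eq_bigr => B _; rewrite gconjM gconjK mulrC.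
split.
- by rewrite Dv addn1 subn_gt0.
- apply/matrixP => i j; rewrite [LHS]mxE [LHS]mxE !AE eq_sym.
  by case: eqP => _; rewrite ?gconj0 ?WC.
- by move=> i; rewrite AE eqxx.
- by move=> i j ij; rewrite AE (negPf ij); apply: (gram_monomial designP).
(* Here [(s + 1)(t - 1) = s t - s + t - 1]. *)
have -> : v%:R - (s.+1 * (t - 1))%:R - 2%:R = s%:R - t%:R :> CG.
  by rewrite Dv natrD !natrM natrB ?(ltnW t_gt1) // -natr1; ring.
have -> : v%:R - 1 = s%:R * t%:R :> CG by rewrite Dv natrD addrK natrM.
rewrite natrB ?(ltnW t_gt1) //; apply: mulmx_shift.
by rewrite -natrD; apply: (gram_mul_gram designP coh).
Qed.

End DesignETF.

(** * Block designs as zero patterns of polyphase matrices *)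

Section DesignBIBD.
Variables (C : numClosedFieldType) (G : finZmodType).
Local Notation CG := (group_ring C G).
Variables (b v : nat) (Phi : 'M[CG]_(b, v)) (s t : nat).

(** Double counting of the pairs formed by a block through [j] and another vertex of it: every
    vertex other than [j] occurs exactly once. *)
Lemma BIBD_replication :
  (forall B, (\sum_j (Phi B j != 0)%R = s.+1)%N) ->
  (forall i j, i != j -> exists! B, Phi B i != 0 /\ Phi B j != 0) ->
  forall j, ((\sum_B (Phi B j != 0)%R) * s = v.-1)%N.
Proof.
move=> rowB pairs j.
have -> : v.-1 = (\sum_(i | i != j) 1)%N.
  by rewrite sum1_card cardC1 card_ord.
have eq_s B : Phi B j != 0 -> (\sum_(i | i != j) (Phi B i != 0)%R = s)%N.
  by move=> Bj; apply/eqP; rewrite -eqSS -(rowB B) [eqbRHS](bigD1 j) //= Bj.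
transitivity (\sum_B \sum_(i | i != j) (Phi B j != 0)%R * (Phi B i != 0)%R)%N.
  rewrite big_distrl; apply: eq_bigr => B _; rewrite -big_distrr /=.
  by case: eqP => //= /eqP Bj; rewrite eq_s.
rewrite exchange_big; apply: eq_bigr => i ij.
have [B [[Bi Bj] B_uniq]] := pairs i j ij.
rewrite (bigD1 B) //= Bi Bj big1 // => B' B'B.
rewrite mulnb; case: andP => // -[B'j B'i].
by case/eqP: B'B; rewrite (B_uniq B').
Qed.

Lemma BIBD_design :
  (forall B j, monomial_or0 (Phi B j)) ->
  BIBD1_incidence v s.+1 (abs2 Phi) ->
  [/\ (0 < s)%N, (s.+1 < v)%N, (s %| v.-1)%N
    & polyphase_design Phi s (v.-1 %/ s)].
Proof.
move=> Phi_mono [blk [blk_inj Eblk [/andP[s_gt0 s_lt] _ blk_card blk_pair]]].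
(* The entries of [abs2 Phi] are 0 or 1, so the blocks are the supports of the rows of [Phi]. *)
have blkE B j : (j \in blk B) = (Phi B j != 0).
  have /matrixP/(_ B j) := Eblk; rewrite !mxE gconj_mul_monomial //.
  case: (_ \in _); case: (_ == _) => //= /eqP; rewrite ?oner_eq0 //.
  by rewrite eq_sym oner_eq0.
have rowB B : (\sum_j (Phi B j != 0)%R = s.+1)%N.
  rewrite -(blk_card (blk B)) ?imset_f // -sum1_card [RHS]big_mkcond.
  by apply: eq_bigr => j _; rewrite blkE; case: ifP.
have pairs i j : i != j -> exists! B, Phi B i != 0 /\ Phi B j != 0.
  move=> /blk_pair[_ [[/imsetP[B _ ->]]]]; rewrite !blkE => Bi Bj B_uniq.
  exists B; split=> // B' [B'i B'j]; apply: blk_inj; apply: B_uniq.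
  by rewrite !blkE imset_f.
have colE := BIBD_replication rowB pairs.
split=> //; first by rewrite -(colE (Ordinal (ltnW s_lt))) dvdn_mull.
by split=> // j; rewrite -(colE j) mulnK.
Qed.

Lemma design_BIBD :
  (0 < s)%N -> (s.+1 < v)%N -> polyphase_design Phi s t ->
  BIBD1_incidence v s.+1 (abs2 Phi).
Proof.
move=> s_gt0 s_lt [Phi_mono rowB _ pairs].
pose blk B := [set j | Phi B j != 0].
have blk_card B : #|blk B| = s.+1.
  rewrite -(rowB B) -sum1_card big_mkcond.
  by apply: eq_bigr => j _; rewrite inE; case: ifP.
exists blk; split.
(* As [s > 0], a block has two vertices, and these determine its row. *)
- move=> B B' eqB; have /card_gt1P[i [j [Bi Bj ij]]] : (1 < #|blk B|)%N.
    by rewrite blk_card ltnS.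
  have [B0 [_ B0_uniq]] := pairs i j ij.
  transitivity B0; first by symmetry; apply: B0_uniq; move: Bi Bj; rewrite !inE.
  by apply: B0_uniq; move: Bi Bj; rewrite eqB !inE.
- apply/matrixP => B j; rewrite !mxE gconj_mul_monomial // inE //.
split=> [||_ /imsetP[B _ ->]|i j ij]; rewrite ?card_ord ?blk_card //.
  by rewrite ltnS s_gt0.
have [B [[Bi Bj] B_uniq]] := pairs i j ij.
exists (blk B); split; first by rewrite imset_f ?inE.
by move=> _ [/imsetP[B' _ ->]]; rewrite !inE => B'i B'j; rewrite (B_uniq B').
Qed.

End DesignBIBD.

(** * Generalized quadrangles *)

Section GQIncidence.

(** Blocks are indexed rather than given as sets, so that the axioms can be checked on ['I_v * G]
    and carried to ordinals by bijections. The third clause replaces both bounds on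
    intersections. *)
Definition GQ_incidence (V I : finType) (inc : I -> V -> bool) (s t : nat) :=
  [/\ (0 < s)%N /\ (0 < t)%N,
      (forall i, \sum_x inc i x = s.+1)%N
        /\ (forall x, \sum_i inc i x = t.+1)%N,
      forall i i' x x', x != x' -> inc i x -> inc i x' ->
        inc i' x -> inc i' x' -> i = i'
    & forall x i, ~~ inc i x ->
        exists! p : V * I, [/\ inc i p.1, inc p.2 p.1 & inc p.2 x]].

Lemma GQ_incidence_bij (V V' I I' : finType)
    (inc : I -> V -> bool) (inc' : I' -> V' -> bool)
    (f : I -> I') (g : V -> V') s t :
  bijective f -> bijective g -> (forall i x, inc i x = inc' (f i) (g x)) ->
  GQ_incidence inc' s t -> GQ_incidence inc s t.
Proof.
move=> f_bij g_bij Einc [st_gt0 [szV szI] lin gq].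
have [f' fK f'K] := f_bij; have [g' gK g'K] := g_bij.
split=> //.
- split=> [i|x].
    rewrite -(szV (f i)) (reindex g (onW_bij _ g_bij)).
    by apply: eq_bigr => x _; rewrite Einc.
  rewrite -(szI (g x)) (reindex f (onW_bij _ f_bij)).
  by apply: eq_bigr => i _; rewrite Einc.
- move=> i i' x x' xx'; rewrite !Einc => ix ix' i'x i'x'.
  apply: (can_inj fK); apply: (lin _ _ (g x) (g x')) => //.
  by rewrite (bij_eq g_bij).
move=> x i; rewrite Einc => /gq[[y j] /= [[iy jy jx] uniq_yj]].
exists (g' y, f' j); split; first by rewrite !Einc /= g'K f'K.
case=> z l /=; rewrite !Einc => -[iz lz lx].
by have [-> ->] := uniq_yj (g z, f l) (And3 iz lz lx); rewrite gK fK.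
Qed.

Section Blocks.
Variables (V I : finType) (blk : I -> {set V}) (s t : nat).

Let sum_mem (A : {set V}) : (\sum_x (x \in A) = #|A|)%N.
Proof.
by rewrite -sum1_card [RHS]big_mkcond; apply: eq_bigr => x _; case: ifP.
Qed.

Let card_blocks (P : pred {set V}) : injective blk ->
  #|[set K in [set blk i | i : I] | P K]| = (\sum_i P (blk i))%N.
Proof.
move=> blk_inj.
have -> : [set K in [set blk i | i : I] | P K] = blk @: [set i | P (blk i)].
  apply/setP => K; rewrite inE; apply/andP/imsetP.
    by case=> /imsetP[i _ ->] Pi; exists i; rewrite ?inE.
  by case=> i; rewrite inE => Pi ->; rewrite imset_f.
rewrite card_imset // -sum1_card big_mkcond.
by apply: eq_bigr => i _; rewrite inE; case: ifP.
Qed.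

Lemma GQ_incidence_inj :
  GQ_incidence (fun i x => x \in blk i) s t -> injective blk.
Proof.
move=> [[s_gt0 _] [szV _] lin _] i i' eq_blk.
have /card_gt1P[x [y [xi yi xy]]] : (1 < #|blk i|)%N.
  by rewrite -sum_mem szV ltnS.
by apply: (lin i i' x y); rewrite // -eq_blk.
Qed.

Lemma GQ_incidenceP : injective blk ->
  GQ_incidence (fun i x => x \in blk i) s t <-> is_GQ s t [set blk i | i : I].
Proof.
move=> blk_inj; split.
  case=> st_gt0 [szV szI] lin gq; split=> //.
  - split=> [_ /imsetP[i _ ->]|x]; first by rewrite -sum_mem.
    by rewrite card_blocks.
  - move=> _ _ /imsetP[i _ ->] /imsetP[i' _ ->] neq; rewrite leqNgt.
    apply/negP => /card_gt1P[x [y [/setIP[xi xi'] /setIP[yi yi'] xy]]].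
    by case/eqP: neq; rewrite (lin i i' x y).
  - move=> x y xy; rewrite leqNgt; apply/negP => /card_gt1P[K [L []]].
    rewrite !inE => /andP[/imsetP[i _ ->] /andP[xi yi]].
    move=> /andP[/imsetP[i' _ ->] /andP[xi' yi']] /eqP[].
    by rewrite (lin i i' x y).
  move=> x _ /imsetP[i _ ->] /gq[[y j] [/= [yi yj xj] uniq_yj]].
  exists (y, blk j); split=> /=; first by rewrite imset_f.
  case=> z _ /= [/imsetP[l _ ->] zi zl xl].
  by have [-> ->] := uniq_yj (z, l) (And3 zi zl xl).
case=> st_gt0 [szV szI] _ lin gq; split=> //.
- split=> [i|x]; first by rewrite sum_mem szV ?imset_f.
  by rewrite -(szI x) card_blocks.
- move=> i i' x y xy xi yi xi' yi'; apply: blk_inj; apply/eqP.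
  apply: contraTT (lin x y xy) => neq; rewrite -ltnNge.
  by apply/card_gt1P; exists (blk i), (blk i'); split=> //;
    rewrite inE imset_f //= ?xi ?xi'.
have blkI i : blk i \in [set blk i | i : I] by rewrite imset_f.
move=> x i /(gq x _ (blkI i))[[y K] [/= [/imsetP[j _ ->] yi yj xj]]].
move=> uniq_yj; exists (y, j); split=> //.
case=> z l /= [zi zl xl].
by have [-> /blk_inj->] := uniq_yj (z, blk l) (And4 (blkI l) zi zl xl).
Qed.

End Blocks.
End GQIncidence.

(** * The quadrangle of a coherent polyphase design *)

Section PolyphaseGQ.
Variables (C : numClosedFieldType) (G : finZmodType).
Local Notation CG := (group_ring C G).

Lemma sum_eq_monomial (x : CG) : monomial_or0 x ->
  (\sum_g (x == monomial C g) = (x != 0)%R)%N.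
Proof.
case=> [->|[h ->]].
  by rewrite eqxx big1 // => g _; rewrite eq_sym (negPf (monomial_neq0 _ _)).
rewrite monomial_neq0 (bigD1 h) //= eqxx big1 // => g /negPf gh.
by rewrite monomial_eq eq_sym gh.
Qed.

(** The exponents telescope: [(p - q') - (p' - q') + (p' - q) = p - q]. Conversely, [x] and [z]
    determine [q'] and [p'], and the equation then gives [y]. Thus a path of vertices and blocks
    that counts at [z^(p - q)] lifts to a path from the block [(B, p)] to the point [(j, q)]. *)
Lemma eq_monomial_mul3 (x y z : CG) p q :
  monomial_or0 x -> monomial_or0 y -> monomial_or0 z ->
  x * (gconj y * z) = monomial C (p - q) <->
  exists p' q', [/\ x = monomial C (p - q'), y = monomial C (p' - q')
                  & z = monomial C (p' - q)].
Proof.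
move=> x_mono y_mono z_mono; split=> [|[p' [q' [-> -> ->]]]]; last first.
  rewrite gconj_monomial -!monomialD opprB [_ - p' + _]addrA subrK.
  by rewrite addrA subrK.
case: x_mono => [->|[a ->]].
  by rewrite mul0r => /esym/eqP; rewrite (negPf (monomial_neq0 _ _)).
case: y_mono => [->|[c ->]].
  by rewrite gconj0 mul0r mulr0 => /esym/eqP; rewrite (negPf (monomial_neq0 _ _)).
case: z_mono => [->|[d ->]].
  by rewrite !mulr0 => /esym/eqP; rewrite (negPf (monomial_neq0 _ _)).
rewrite gconj_monomial -!monomialD => /eqP; rewrite monomial_eq => /eqP acd.
exists (d + q), (p - a); rewrite subKr addrK; split=> //; congr monomial.
apply/eqP; rewrite eq_sym subr_eq; apply/eqP.
have -> : p = a + (- c + d + q) by rewrite addrA acd subrK.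
by rewrite [a + _]addrC addrK !addrA subrr add0r.
Qed.

Variables (b v : nat) (Phi : 'M[CG]_(b, v)) (s t : nat).

(** The incidence relation behind [Z]: [inl i] is the spread block, or fibre, over the vertex [i],
    and the test on [Phi] says that [Phi(T)] has entry 1 in row [(B, p)] and column [(j, q)]. *)
Definition polyphase_incidence (K : 'I_v + 'I_b * G) (x : 'I_v * G) : bool :=
  match K with
  | inl i => i == x.1
  | inr Bp => Phi Bp.1 x.1 == monomial C (Bp.2 - x.2)
  end.

Hypothesis Phi_mono : forall B j, monomial_or0 (Phi B j).

Lemma sum_polyphase_row B p :
  (\sum_x polyphase_incidence (inr (B, p)) x = \sum_j (Phi B j != 0)%R)%N.
Proof.
rewrite (eq_bigr (fun x => (Phi B x.1 == monomial C (p - x.2)) : nat)) //.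
rewrite -(pair_bigA _ (fun j g => (Phi B j == monomial C (p - g)) : nat)) /=.
apply: eq_bigr => j _; rewrite -(sum_eq_monomial (Phi_mono B j)).
rewrite (reindex_inj (inv_inj (subKr p))) /=.
by apply: eq_bigr => g _; rewrite subKr.
Qed.

Lemma sum_polyphase_spread (G1 : #|G| = s.+1) i :
  (\sum_x polyphase_incidence (inl i) x = s.+1)%N.
Proof.
rewrite -(pair_bigA _ (fun j (g : G) => (i == j) : nat)) /=.
rewrite (bigD1 i) //= eqxx sum_nat_const muln1 G1 big1 ?addn0 //= => j ji.
by rewrite sum_nat_const eq_sym (negPf ji) muln0.
Qed.

Lemma sum_polyphase_col x :
  (\sum_K polyphase_incidence K x = (\sum_B (Phi B x.1 != 0)%R).+1)%N.
Proof.
rewrite big_sumType /= -add1n; congr (_ + _)%N.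
  by rewrite (bigD1 x.1) //= eqxx big1 // => i /negPf->.
rewrite -(pair_bigA _ (fun B p => (Phi B x.1 == monomial C (p - x.2)) : nat)) /=.
apply: eq_bigr => B _; rewrite -(sum_eq_monomial (Phi_mono B _)).
rewrite (reindex_inj (addIr x.2)) /=.
by apply: eq_bigr => g _; rewrite addrK.
Qed.

(** The quadrangle axiom has three cases. For a fibre it comes from the block through two vertices;
    for a block [(B, p)], from the fibre over [j] if [j] is on [B], and from coherence if not. *)
Lemma design_GQ :
  (0 < s)%N -> (0 < t)%N -> #|G| = s.+1 -> polyphase_design Phi s t ->
  coherent Phi -> GQ_incidence polyphase_incidence s t.
Proof.
move=> s_gt0 t_gt0 G1 designP coh; have [_ rowB colj pairs] := designP.
have incP B p j q : polyphase_incidence (inr (B, p)) (j, q) ->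
    Phi B j = monomial C (p - q) by move/eqP.
have incN B p j q : polyphase_incidence (inr (B, p)) (j, q) -> Phi B j != 0.
  by move/incP->; apply: monomial_neq0.
have inc_eq B p p' j q : polyphase_incidence (inr (B, p)) (j, q) ->
    polyphase_incidence (inr (B, p')) (j, q) -> p = p'.
  by move=> /incP E /incP; rewrite E => /eqP; rewrite monomial_eq => /eqP/addIr.
have inc_eqr B p j q q' : polyphase_incidence (inr (B, p)) (j, q) ->
    polyphase_incidence (inr (B, p)) (j, q') -> q = q'.
  move=> /incP E /incP; rewrite E => /eqP.
  by rewrite monomial_eq => /eqP/addrI/oppr_inj.
have pairs_eq i j B B' : i != j -> Phi B i != 0 -> Phi B j != 0 ->
    Phi B' i != 0 -> Phi B' j != 0 -> B = B'.
  by move=> /pairs[B0 [_ uB]] *; rewrite -(uB B) // -(uB B').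
have ex_mono B j : Phi B j != 0 -> exists g, Phi B j = monomial C g.
  by move=> Bj; case: (Phi_mono B j) => [/eqP|//]; rewrite (negPf Bj).
split=> //.
- split=> [[i|[B p]]|x]; first exact: sum_polyphase_spread.
    by rewrite sum_polyphase_row.
  by rewrite sum_polyphase_col colj.
- move=> K K' [j q] [j' q'] xx' Kx Kx' K'x K'x'.
  (* Two points of one fibre share only that fibre; points of different fibres can share only a
     block over the one that joins their vertices. *)
  have [jj'|jj'] := eqVneq j j'.
    subst j'; have qq' : q != q' by apply: contra_neq xx' => ->.
    case: K Kx Kx' => [i /eqP/= -> _|[B p] Kx /(inc_eqr _ _ _ _ _ Kx)]; last first.
      by move=> E; rewrite E eqxx in qq'.
    case: K' K'x K'x' => [i' /eqP/= -> //|[B p] K'x /(inc_eqr _ _ _ _ _ K'x)].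
    by move=> E; rewrite E eqxx in qq'.
  case: K Kx Kx' => [i /eqP/= -> /eqP/= /eqP|[B p] Kx Kx'].
    by rewrite (negPf jj').
  case: K' K'x K'x' => [i /eqP/= -> /eqP/= /eqP|[B' p'] K'x K'x'].
    by rewrite (negPf jj').
  have BB' : B = B' by apply: (pairs_eq j j'); eauto.
  by subst B'; rewrite (inc_eq _ _ _ _ _ Kx K'x).
move=> [j q] [i|[B p]] /= nKx.
  (* The copy of [B] through [(j, q)] is the one of index [g + q], and it meets the fibre over [i]
     at [g + q - h]. *)
  have [B [[Bi Bj] _]] := pairs _ _ nKx.
  have [g Eg] := ex_mono _ _ Bj; have [h Eh] := ex_mono _ _ Bi.
  have Kx : polyphase_incidence (inr (B, g + q)) (j, q).
    by rewrite /= Eg addrK.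
  have Ky : polyphase_incidence (inr (B, g + q)) (i, g + q - h).
    by rewrite /= Eh subKr.
  exists ((i, g + q - h), inr (B, g + q)); split; first by rewrite eqxx.
  case=> -[i1 q1] [i2 [/= /eqP <-]|[B' p'] [/= /eqP <-]].
    by move=> /eqP -> /eqP ij; rewrite ij eqxx in nKx.
  move=> K'y K'x; have BB' : B = B'.
    by apply: (pairs_eq i j) => //; [apply: incN K'y|apply: incN K'x].
  subst B'; have E := inc_eq _ _ _ _ _ Kx K'x; subst p'.
  by rewrite (inc_eqr _ _ _ _ _ Ky K'y).
(* If [j] is on [B], a connecting block over some [B'] through another vertex of [B] would have
   [B' = B] and so be [(B, p)] itself, which misses the point. *)
have [Bj|Bj] := eqVneq (Phi B j) 0; last first.
  have [h Eh] := ex_mono _ _ Bj.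
  have Ky : polyphase_incidence (inr (B, p)) (j, p - h) by rewrite /= Eh subKr.
  exists ((j, p - h), inl j); split=> [|[[i1 q1] [i2|[B' p']]]] /=.
    by rewrite eqxx; split.
  case=> Kz /eqP -> /eqP i1j; subst i1.
  by rewrite (inc_eqr _ _ _ _ _ Ky Kz).
  case=> Kz K'z K'x; have [i1j|i1j] := eqVneq i1 j.
    subst i1; have qE := inc_eqr _ _ _ _ _ K'z K'x; subst q1.
    by rewrite Kz in nKx.
  have BB' : B = B'.
    by apply: (pairs_eq i1 j) => //;
      [apply: incN Kz|apply: incN K'z|apply: incN K'x].
  subst B'; have E := inc_eq _ _ _ _ _ Kz K'z; subst p'.
  by rewrite K'x in nKx.
(* The coefficient 1 of 1(z) at [z^(p - q)] leaves exactly one path [(i, B')]. *)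
have := coef_row_mul_gram designP B j (p - q); rewrite coh // gcoef_all_ones.
move/esym/eqP; rewrite pnatr_eq1 => /cards1P[[i B'] /setP uniq_iB].
have := uniq_iB (i, B'); rewrite !inE eqxx => /eqP.
case/eq_monomial_mul3 => // p' [q' [/= Ky K'y K'x]].
exists ((i, q'), inr (B', p')); split=> [/=|]; first by rewrite Ky K'y K'x.
case=> -[i1 q1] [i2 [/= Kz /eqP E /eqP i1j]|[B1 p1] [Kz K1z K1x]].
  by move: Kz; rewrite -E i1j Bj eq_sym (negPf (monomial_neq0 _ _)).
have /eqP[Ei EB] : (i1, B1) == (i, B').
  have := uniq_iB (i1, B1); rewrite !inE => <-; apply/eqP.
  apply/eq_monomial_mul3 => //; exists p1, q1.
  by split; apply/eqP.
subst i1 B1.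
have E : p' = p1 by apply: (inc_eq B' _ _ j q) => //; apply/eqP.
have E' : q' = q1 by apply: (inc_eqr B p i) => //; apply/eqP.
by rewrite E E'.
Qed.

(** The same cases read backwards: the axiom at a fibre gives the block through two vertices, and at
    [(B, d)] with [j] off [B] it gives the coefficient 1 at [z^d]. *)
Lemma GQ_design :
  GQ_incidence polyphase_incidence s t ->
  polyphase_design Phi s t /\ coherent Phi.
Proof.
move=> [_ [szV szI] _ gq].
have ex_mono B j : Phi B j != 0 -> exists g, Phi B j = monomial C g.
  by move=> Bj; case: (Phi_mono B j) => [/eqP|//]; rewrite (negPf Bj).
have designP : polyphase_design Phi s t.
  split=> // [B|j|i j ij].
  - by rewrite -(sum_polyphase_row B 0) szV.
  (* One of the [t + 1] blocks on a point is its fibre. *)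
  - by apply/eqP; rewrite -eqSS -(szI (j, 0)) sum_polyphase_col.
  have nKx : ~~ polyphase_incidence (inl j) (i, 0) by rewrite /= eq_sym.
  have [[[i1 q1] [i2|[B p]]] [[/= /eqP <- Ky Kx] uniq_yK]] := gq _ _ nKx.
    by case/eqP: ij; rewrite -(eqP Ky) -(eqP Kx).
  exists B; split=> [|B' [/ex_mono[h Eh] /ex_mono[h' Eh']]].
    by rewrite (eqP Kx) (eqP Ky) !monomial_neq0.
  (* The copy of [B'] through [(i, 0)] has index [h] and meets the fibre over [j] at [h - h']. *)
  have /= := uniq_yK ((j, h - h'), inr (B', h)).
  rewrite Eh Eh' subKr subr0 !eqxx => /(_ (And3 isT isT isT)) [_ -> //].
split=> // B j Bj; apply: group_ringP => d.
rewrite gcoef_all_ones (coef_row_mul_gram designP).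
have nKx : ~~ polyphase_incidence (inr (B, d)) (j, 0).
  by rewrite /= Bj eq_sym monomial_neq0.
have [[[i q] [i2|[B' p]]] [[/= Ky K'y K'x] uniq_yK]] := gq _ _ nKx.
  by move: Ky; rewrite -(eqP K'y) (eqP K'x) Bj eq_sym (negPf (monomial_neq0 _ _)).
apply/eqP; rewrite pnatr_eq1; apply/cards1P; exists (i, B').
apply/setP => -[i1 B1]; rewrite !inE /= -[d]subr0.
apply/eqP/eqP => [|[-> ->]].
  case/eq_monomial_mul3 => // p1 [q1 [Kz K1z K1x]].
  have /= := uniq_yK ((i1, q1), inr (B1, p1)).
  by rewrite Kz K1z K1x !eqxx => /(_ (And3 isT isT isT)) [-> _ ->].
apply/eq_monomial_mul3 => //; exists p, q.
by rewrite (eqP Ky) (eqP K'y) (eqP K'x).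
Qed.

End PolyphaseGQ.

(** * The incidence matrix with its spread on top *)

Section SpreadStack.
Variables (C : numClosedFieldType) (G : finZmodType).
Local Notation CG := (group_ring C G).
Variables (k b v : nat) (e : 'I_k -> G).
Hypothesis e_bij : bijective e.

Definition point_of (j : 'I_(v * k)) : 'I_v * G :=
  ((mxtens_unindex j).1, e (mxtens_unindex j).2).

Definition block_of (i : 'I_(v * 1 + b * k)) : 'I_v + 'I_b * G :=
  match split i with
  | inl i1 => inl (mxtens_unindex i1).1
  | inr i2 => inr ((mxtens_unindex i2).1, e (mxtens_unindex i2).2)
  end.

Lemma point_of_bij : bijective point_of.
Proof.
have [f eK fK] := e_bij.
exists (fun x => mxtens_index (x.1, f x.2)) => [j|[j g]].
  by case: (mxtens_indexP j) => j1 j2; rewrite /point_of mxtens_indexK /= eK.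
by rewrite /point_of mxtens_indexK /= fK.
Qed.

Lemma block_of_bij : bijective block_of.
Proof.
have [f eK fK] := e_bij.
exists (fun K => match K with
  | inl i => lshift (b * k) (mxtens_index (i, ord0 : 'I_1))
  | inr Bp => rshift (v * 1) (mxtens_index (Bp.1, f Bp.2))
  end) => [i|[i|[B p]]].
- rewrite -[RHS]splitK /block_of.
  case: (split i) => i1; case: (mxtens_indexP i1) => j1 j2; rewrite mxtens_indexK.
    by rewrite [j2]ord1.
  by rewrite /= eK.
- by rewrite /block_of (unsplitK (inl _)) mxtens_indexK.
by rewrite /block_of (unsplitK (inr _)) mxtens_indexK /= fK.
Qed.

Variable Phi : 'M[CG]_(b, v).
Hypothesis Phi_mono : forall B j, monomial_or0 (Phi B j).

Lemma spread_stackE i j :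
  spread_stack (filter_bank e Phi) i j =
  (polyphase_incidence Phi (block_of i) (point_of j))%:R.
Proof.
rewrite /spread_stack mxE /block_of; case: splitP => i1 _ /=.
  by rewrite !mxE mulr1.
by rewrite mxE filter_blockE gcoef_monomial_or0.
Qed.

Lemma GQ_spread_filter_bank s t :
  GQ_incidence (polyphase_incidence Phi) s t ->
  GQ_spread_incidence s t (spread_stack (filter_bank e Phi)).
Proof.
move=> gq.
pose blk i := [set j | polyphase_incidence Phi (block_of i) (point_of j)].
have gq_blk : GQ_incidence (fun i j => j \in blk i) s t.
  apply: GQ_incidence_bij block_of_bij point_of_bij _ gq => i j.
  by rewrite inE.
have blk_inj := GQ_incidence_inj gq_blk.
exists blk; split=> //.
- by apply/matrixP => i j; rewrite spread_stackE mxE inE.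
- exact/GQ_incidenceP.
have blkl i j : (j \in blk (lshift _ i)) =
    ((mxtens_unindex i).1 == (mxtens_unindex j).1).
  by rewrite inE /block_of (unsplitK (inl _)).
split; first by apply/subsetP => _ /imsetP[i _ ->]; rewrite imset_f.
apply/and3P; split.
- apply/eqP/setP => j; rewrite inE; apply/bigcupP.
  pose i : 'I_(v * 1) := mxtens_index ((mxtens_unindex j).1, ord0).
  exists (blk (lshift _ i)); first by apply/imsetP; exists i.
  by rewrite blkl mxtens_indexK.
- apply/trivIsetP => _ _ /imsetP[i _ ->] /imsetP[i' _ ->]; apply: contraNT.
  case/pred0Pn => j /andP[/=]; rewrite !blkl => /eqP <- /eqP ii'.
  suff -> : i = i' by [].
  case: (mxtens_indexP i) (mxtens_indexP i') ii' => i1 i2 [i1' i2'].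
  by rewrite !mxtens_indexK [i2]ord1 [i2']ord1 => /= ->.
(* A partition has no empty member, and each block has [s + 1] points. *)
apply/imsetP => -[i _ E]; have [_ [szV _] _ _] := gq_blk.
have := szV (lshift _ i); rewrite -E big1 // => j _.
by rewrite inE.
Qed.

Lemma GQ_of_spread_filter_bank s t :
  GQ_spread_incidence s t (spread_stack (filter_bank e Phi)) ->
  GQ_incidence (polyphase_incidence Phi) s t.
Proof.
move=> [blk [blk_inj Eblk /(GQ_incidenceP _ _ blk_inj) gq _]].
have [f fK f'K] := block_of_bij; have [g gK g'K] := point_of_bij.
apply: (GQ_incidence_bij (f := f) (g := g)) gq;
  [by exists block_of|by exists point_of|].
move=> K x; have /matrixP/(_ (f K) (g x)) := Eblk.
rewrite spread_stackE mxE f'K g'K => /eqP.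
by rewrite eqr_nat; case: polyphase_incidence; case: (_ \in _).
Qed.

End SpreadStack.

(** * Circulant permutation blocks as monomials *)

Section CirculantBlocks.
Variables (C : numClosedFieldType) (G : finZmodType).
Local Notation CG := (group_ring C G).
Variables (k b v : nat) (e : 'I_k -> G).
Hypothesis e_bij : bijective e.

(** A circulant matrix is determined by its column at the group element 0. For a permutation matrix
    this column has a single 1, in row [p0], which makes the matrix the translation by [e p0]. *)
Lemma circulant_filter_block (L : 'M[C]_k) :
  (is_perm_mx L /\ circulant e L) \/ L = 0 ->
  exists2 x : CG, monomial_or0 x & L = filter_block e x.
Proof.
case=> [[/is_perm_mxP[s ->] circ]|->]; last first.
  exists 0; first by left.
  by apply/matrixP => i j; rewrite filter_blockE gcoef0 mxE.
have [f eK fK] := e_bij; pose p0 := (s^-1)%g (f 0).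
exists (monomial C (e p0)); first by right; exists (e p0).
apply/matrixP => i j; rewrite filter_blockE gcoef_monomial.
rewrite (circ i j (f (e i - e j)) (f 0)) ?fK // !mxE.
congr (nat_of_bool _)%:R.
by rewrite -[X in _ == X](permKV s) (inj_eq perm_inj) -/p0 (can2_eq fK eK).
Qed.

Lemma filter_bank_of_blocks (Y : 'M[C]_(b * k, v * k)) :
  (forall B j, (is_perm_mx (kblock Y B j) /\ circulant e (kblock Y B j))
               \/ kblock Y B j = 0) ->
  exists2 Phi : 'M[CG]_(b, v),
    (forall B j, monomial_or0 (Phi B j)) & Y = filter_bank e Phi.
Proof.
move=> Y_blocks.
have [Phi Phi_mono EPhi] := fin_all_exists2 (fun Bj : 'I_b * 'I_v =>
  circulant_filter_block (Y_blocks Bj.1 Bj.2)).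
exists (\matrix_(B, j) Phi (B, j)) => [B j|]; first by rewrite mxE.
apply/matrixP => i j; rewrite !mxE -EPhi mxE.
by rewrite -!surjective_pairing !mxtens_unindexK.
Qed.

End CirculantBlocks.

Theorem theorem4p3 (R : realType) (G : finZmodType) :
  [/\ (* (1) *)
      forall (v k b : nat) (e : 'I_k -> G)
             (Phi : 'M[group_ring R[i] G]_(b, v)),
        bijective e ->
        polyphase_BIBD_ETF v k k Phi ->
        (k - 1 %| v - 1)%N /\
        GQ_spread_incidence (k - 1) ((v - 1) %/ (k - 1))
          (spread_stack (filter_bank e Phi)),
      (* (2) *)
      forall (s t b : nat) (e : 'I_s.+1 -> G)
             (Y : 'M[R[i]]_(b * s.+1, (s * t + 1) * s.+1)),
        (1 <= s)%N -> (2 <= t)%N ->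
        #|G| = s.+1 -> bijective e ->
        (b * s.+1 = t * (s * t + 1))%N ->
        GQ_spread_incidence s t (spread_stack Y) ->
        (forall i j, (is_perm_mx (kblock Y i j) /\ circulant e (kblock Y i j))
                     \/ kblock Y i j = 0) ->
        exists Phi : 'M[group_ring R[i] G]_(b, s * t + 1),
          polyphase_BIBD_ETF (s * t + 1) s.+1 s.+1 Phi /\ Y = filter_bank e Phi,
      (* (3) *)
      forall (v k s t b : nat) (Phi : 'M[group_ring R[i] G]_(b, v)),
        k = s.+1 -> v = (s * t + 1)%N ->
        polyphase_BIBD_ETF v k k Phi ->
        (forall gamma : G -> R[i], is_character gamma -> nontrivial gamma ->
           [/\ is_ETF (mxev gamma Phi),
               (\rank (mxev gamma Phi))%:R
                 = (t * (s * t + 1))%:R / (s + t)%:R :> rat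
             & v%:R - (\rank (mxev gamma Phi))%:R
                 = (s * (s * t + 1))%:R / (s + t)%:R :> rat]) /\
        (~~ odd s.+1 ->
         exists gamma : G -> R[i],
           [/\ is_character gamma, nontrivial gamma
             & is_real_ETF (mxev gamma Phi)])
    & (* (4) *)
      forall (v k s t b : nat) (Phi : 'M[group_ring R[i] G]_(b, v)),
        k = s.+1 -> v = (s * t + 1)%N ->
        polyphase_BIBD_ETF v k k Phi ->
        abelian_DRACKN v s.+1 (t - 1) (padj Phi *m Phi - t%:R%:M)].
Proof.
split.
- move=> v [|s] b e Phi e_bij [Gk Phi_mono bibd etf].
    by case: bibd => blk [_ _ []].
  have [s_gt0 s_lt s_dvd designP] := BIBD_design Phi_mono bibd.
  rewrite !subn1 /=; split=> //; apply: (GQ_spread_filter_bank e_bij Phi_mono).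
  apply: design_GQ => //; last exact: (ETF_coherent designP).
  by rewrite divn_gt0 // dvdn_leq // -subn1 subn_gt0; apply: leq_trans s_lt.
- move=> s t b e Y s_gt0 t_gt1 Gs e_bij _ gqY Y_blocks.
  have [Phi Phi_mono EY] := filter_bank_of_blocks e_bij Y_blocks.
  exists Phi; split=> //; move: gqY; rewrite EY.
  move=> /(GQ_of_spread_filter_bank e_bij Phi_mono).
  move=> /(GQ_design Phi_mono)[designP coh]; split=> //; last first.
    by move=> gamma *; apply: (coherent_ETF designP) => //; apply: ltnW.
  apply: (design_BIBD s_gt0 _ designP).
  by rewrite addn1 ltnS -{1}[s]muln1 ltn_mul2l s_gt0.
- move=> v k s t b Phi -> Dv [Gk Phi_mono bibd etf].
  have [s_gt0 s_lt _] := BIBD_design Phi_mono bibd.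
  (* The replication number of the design is the given [t]. *)
  have -> : (v.-1 %/ s = t)%N by rewrite Dv addn1 mulKn.
  move=> designP; have coh := ETF_coherent designP Gk etf.
  have t_gt0 : (0 < t)%N.
    by move: s_lt; rewrite Dv; case: (t) => //; rewrite muln0.
  have st0 : (s + t)%:R != 0 :> rat.
    by rewrite pnatr_eq0 addn_eq0 negb_and -!lt0n s_gt0.
  split=> [gamma g_char g_nt|s_odd].
    split; first exact: etf.
      (* Both formulas come from [(s + t) d = v t], the second after subtraction from
         [(s + t) v]. *)
      have := coherent_rank designP t_gt0 coh g_char g_nt.
      move: (\rank _) => d; rewrite Dv => /(congr1 (fun n => n%:R : rat)).
      rewrite !natrM => rankE; apply: (mulfI st0); rewrite rankE.
      by move: st0; rewrite !natrD !natrM => st0; field.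
    have := coherent_rank designP t_gt0 coh g_char g_nt.
    move: (\rank _) => d; rewrite Dv => /(congr1 (fun n => n%:R : rat)).
    rewrite !natrM => rankE; apply: (mulfI st0); rewrite mulrBr rankE.
    by move: st0; rewrite !natrD !natrM => st0; field.
  have [|gamma [g_char g_nt g_real]] := @real_nontrivial_character R[i] G.
    by rewrite Gk.
  exists gamma; split=> //; split; last exact: etf.
  move=> B j; rewrite mxE; case: (Phi_mono B j) => [->|[g ->]].
    by rewrite ev0 rpred0.
  by rewrite ev_monomial.
move=> v k s t b Phi -> Dv [Gk Phi_mono bibd etf].
have [s_gt0 s_lt _] := BIBD_design Phi_mono bibd.
have -> : (v.-1 %/ s = t)%N by rewrite Dv addn1 mulKn.
move=> designP; have coh := ETF_coherent designP Gk etf.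
apply: (coherent_DRACKN designP) => //.
(* The BIBD bound [s + 1 < s t + 1] forces [t > 1]. *)
by move: s_lt; rewrite Dv addn1 ltnS -{1}[s]muln1 ltn_mul2l s_gt0.
Qed.
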